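(* Let $I$ be a monomial ideal of $S=K[t_1,\ldots,t_s]$ and let $I=\mathfrak{q}_1\cap\cdots\cap\mathfrak{q}_m$ be the irreducible decomposition of $I$. Then ${\rm NP}(I)={\rm IP}(I)$ if and only if $\overline{I^n}=\overline{\mathfrak{q}_1^n}\cap\cdots\cap\overline{\mathfrak{q}_m^n}$ for all $n\geq 1$.
   Context: $K$ is a field, $\mathbb{N}=\{0,1,\ldots\}$, $\mathbb{R}_+$ is the set of non-negative reals, $t^a=t_1^{a_1}\cdots t_s^{a_s}$ for $a\in\mathbb{N}^s$, and $e_i$ is the $i$-th unit vector of $\mathbb{R}^s$. Monomial ideals are nonzero and proper; $\overline{L}$ is the integral closure of an ideal $L$. If $I$ is minimally generated by $t^{v_1},\ldots,t^{v_q}$, its Newton polyhedron is ${\rm NP}(I)=\mathbb{R}_+^s+{\rm conv}(v_1,\ldots,v_q)$. For $b\in\mathbb{N}^s\setminus\{0\}$, set $\mathfrak{q}_b:=(\{t_i^{b_i}\mid b_i\geq 1\})$ and $b^{-1}:=\sum_{b_i\geq 1}b_i^{-1}e_i$. The irreducible decomposition of $I$ is the unique (up to order) expression $I=\mathfrak{q}_1\cap\cdots\cap\mathfrak{q}_m$ where each $\mathfrak{q}_i=\mathfrak{q}_{\alpha_i}$ for some $\alpha_i\in\mathbb{N}^s\setminus\{0\}$ and $I\neq\bigcap_{i\neq j}\mathfrak{q}_i$ for $j=1,\ldots,m$. The irreducible polyhedron of $I$ is ${\rm IP}(I)=\{x\in\mathbb{R}^s\mid x\geq 0;\ \langle x,\alpha_i^{-1}\rangle\geq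 1 \text{ for } i=1,\ldots,m\}$. *)

(* Defs.v *)
From mathcomp Require Import all_boot all_order all_algebra.
From mathcomp Require Import boolp classical_sets reals.
From mathcomp Require Import mpoly.

Set Implicit Arguments.
Unset Strict Implicit.
Unset Printing Implicit Defensive.

Import Order.TTheory GRing.Theory Num.Theory.

Local Open Scope classical_set_scope.
Local Open Scope ring_scope.

Section Ideals.
Variable A : comNzRingType.
Implicit Types (G L : set A) (n : nat).

Definition ideal_gen G : set A :=
  [set x | exists (k : nat) (c g : 'I_k -> A),
      (forall i, G (g i)) /\ x = \sum_(i < k) c i * g i].

Definition ideal_pow L n : set A :=
  ideal_gen [set x | exists f : 'I_n -> A,
                       (forall i, L (f i)) /\ x = \prod_(i < n) f i].

(* f ^+ n + a 1 * f ^+ (n - 1) + ... + a n = 0, where a i lies in L ^ i. *)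
Definition integral_closure L : set A :=
  [set f | exists (n : nat) (a : nat -> A),
      [/\ (0 < n)%N,
          forall i, (1 <= i <= n)%N -> ideal_pow L i (a i)
        & f ^+ n + \sum_(1 <= i < n.+1) a i * f ^+ (n - i) = 0]].

End Ideals.

Section MonomialIdeals.
Variables (K : fieldType) (s : nat).
Implicit Types (I : set {mpoly K[s]}) (b : 'X_{1..s}).

Definition monomial_gen (G : set 'X_{1..s}) : set {mpoly K[s]} :=
  ideal_gen [set 'X_[K, m] | m in G].

Definition monomial_ideal I :=
  [/\ exists G : set 'X_{1..s}, I = monomial_gen G,
      I <> [set 0]
    & I <> setT].

Definition minimally_generated I (q : nat) (v : 'I_q -> 'X_{1..s}) :=
  I = monomial_gen (range v) /\
  forall j, I <> monomial_gen [set v k | k in [set k | k <> j]].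

Definition irr_ideal b : set {mpoly K[s]} :=
  ideal_gen [set f | exists i : 'I_s, (1 <= b i)%N /\ f = 'X_i ^+ b i].

Definition irreducible_decomposition I (m : nat) (alpha : 'I_m -> 'X_{1..s}) :=
  [/\ forall j, alpha j <> 0%MM,
      I = \bigcap_j irr_ideal (alpha j)
    & forall j, I <> \bigcap_(k in [set k | k <> j]) irr_ideal (alpha k)].

End MonomialIdeals.

Section Polyhedra.
Variables (R : realType) (s : nat).
Implicit Types (x y : 'rV[R]_s) (b : 'X_{1..s}).

Definition dotp x y : R := \sum_(i < s) x 0 i * y 0 i.

Definition expvec b : 'rV[R]_s := \row_(i < s) (b i)%:R.

Definition invvec b : 'rV[R]_s :=
  \row_(i < s) (if (1 <= b i)%N then (b i)%:R^-1 else 0).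

Definition nonneg_orthant : set 'rV[R]_s := [set x | forall i, 0 <= x 0 i].

Definition conv_hull (q : nat) (p : 'I_q -> 'rV[R]_s) : set 'rV[R]_s :=
  [set x | exists lam : 'I_q -> R,
      [/\ forall k, 0 <= lam k, \sum_(k < q) lam k = 1
        & x = \sum_(k < q) lam k *: p k]].

(* The minimal monomial generators of I are unique up to order, so the
   existential below does not make the set depend on a choice. *)
Definition Newton_polyhedron (K : fieldType) (I : set {mpoly K[s]}) :
    set 'rV[R]_s :=
  [set x | exists (q : nat) (v : 'I_q -> 'X_{1..s}),
      minimally_generated I v /\
      exists y z, [/\ nonneg_orthant y, conv_hull (expvec \o v) z
                    & x = y + z]].

Definition irreducible_polyhedron (m : nat) (alpha : 'I_m -> 'X_{1..s}) :
    set 'rV[R]_s :=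
  [set x | nonneg_orthant x /\ forall j, 1 <= dotp x (invvec (alpha j))].

End Polyhedra.

Arguments irr_ideal K {s} b.
Arguments Newton_polyhedron R {s K} I.
Arguments irreducible_polyhedron R {s m} alpha.

(* Main.v *)
Require Import Defs.
From mathcomp Require Import all_boot all_order all_algebra.
From mathcomp Require Import boolp classical_sets reals.
From mathcomp Require Import mpoly.
From HB Require Import structures.
From mathcomp Require Import ring lra.

Set Implicit Arguments.
Unset Strict Implicit.
Unset Printing Implicit Defensive.

Import Order.TTheory GRing.Theory Num.Theory.

Local Open Scope classical_set_scope.
Local Open Scope ring_scope.

(** Both conditions compare exponent vectors, because integral closures of
    monomial ideals are governed by linear inequalities.

    One direction of this correspondence is valuative.  A weight w >= 0 on the
    variables gives each polynomial f an order, the least weight of its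
    monomials; this order is multiplicative, since the initial forms multiply
    in a domain.  Hence integral dependence cannot lower it: if all elements of
    L have order at least c, so do all elements of the integral closure of L
    (weight_ge_closure).

    The other direction is combinatorial.  If a monomial t^a has a power t^(p a)
    in L^p, it is integral over L, and sums of integral elements are integral by
    the classical argument over the Rees algebra (integral_closure_sum).  When
    a / n lies in the Newton polyhedron of I, such a p for L = I^n is a common
    denominator of rational coefficients expressing a / n as a convex
    combination of generators plus a nonnegative vector; linear programming
    duality allows the real coefficients to be replaced by rational ones
    (Newton_closure_monomial).  For an irreducible ideal q_b the combinatorial
    condition is the single inequality <a, b^-1> >= n
    (irr_ideal_closure_monomial).

    If NP(I) = IP(I), let f lie in the integral closures of all the q_j^n.  By
    the valuative direction with the weights alpha_j^-1, each exponent a of f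
    has a / n in IP(I) = NP(I), so f is integral over I^n by the combinatorial
    direction; the other inclusion is monotonicity.

    Conversely NP(I) is always contained in IP(I).  If a point x of IP(I) were
    not in NP(I), Farkas' lemma would separate it from NP(I) by a weight w >= 0.
    Since the separation is strict, x can be rounded up to a rational point
    a / n that is still separated and still in IP(I)
    (Newton_polyhedron_rounding).  Then t^a is integral over all the q_j^n but,
    by the valuative direction for w, not over I^n. *)

(** * Powers of ideals *)

Section IdealPowers.
Variable A : comNzRingType.
Implicit Types (G L : set A) (n p : nat).

Lemma ideal_gen_mem G x : G x -> ideal_gen G x.
Proof.
move=> Gx; exists 1%N, (fun=> 1), (fun=> x); split => //.
by rewrite big_ord1 mul1r.
Qed.

Lemma ideal_gen0 G : ideal_gen G 0.
Proof.
exists 0%N, (fun=> 1), (fun=> 0); split; last by rewrite big_ord0.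
by case.
Qed.

Lemma ideal_genD G x y : ideal_gen G x -> ideal_gen G y -> ideal_gen G (x + y).
Proof.
move=> [k [c [g [Gg ->]]]] [k' [c' [g' [Gg' ->]]]].
exists (k + k')%N, (fun i : 'I_(k + k') => match split i with inl a => c a | inr b => c' b end),
  (fun i : 'I_(k + k') => match split i with inl a => g a | inr b => g' b end).
split; first by move=> i; case: split.
rewrite big_split_ord /=; congr (_ + _); apply: eq_bigr => i _.
  by rewrite (unsplitK (inl i)).
by rewrite (unsplitK (inr i)).
Qed.

Lemma ideal_genMl G c x : ideal_gen G x -> ideal_gen G (c * x).
Proof.
move=> [k [d [g [Gg ->]]]]; exists k, (fun i => c * d i), g; split => //.
by rewrite mulr_sumr; apply: eq_bigr => i _; rewrite mulrA.
Qed.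

Lemma ideal_genN G x : ideal_gen G x -> ideal_gen G (- x).
Proof. by rewrite -mulN1r; apply: ideal_genMl. Qed.

Lemma ideal_gen_sum G (T : eqType) (r : seq T) (F : T -> A) :
  (forall k, k \in r -> ideal_gen G (F k)) -> ideal_gen G (\sum_(k <- r) F k).
Proof.
move=> GF; rewrite big_seq; elim/big_ind: _ => //; first exact: ideal_gen0.
by move=> x y; apply: ideal_genD.
Qed.

Lemma ideal_gen_ind G (P : set A) :
  P 0 -> (forall x y, P x -> P y -> P (x + y)) ->
  (forall c g, G g -> P (c * g)) -> ideal_gen G `<=` P.
Proof.
move=> P0 PD PM _ [k [c [g [Gg ->]]]].
by elim/big_ind: _ => // i _; apply: PM.
Qed.

Lemma ideal_genS G G' : G `<=` ideal_gen G' -> ideal_gen G `<=` ideal_gen G'.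
Proof.
move=> GG'; apply: ideal_gen_ind; first exact: ideal_gen0.
  by move=> x y; apply: ideal_genD.
by move=> c g /GG'; apply: ideal_genMl.
Qed.

Lemma ideal_powS L L' n : L `<=` L' -> ideal_pow L n `<=` ideal_pow L' n.
Proof.
move=> LL'; apply: ideal_genS => x [f [Lf ->]].
by apply: ideal_gen_mem; exists f; split => // i; apply: LL'.
Qed.

Lemma integral_closureS L L' :
  L `<=` L' -> integral_closure L `<=` integral_closure L'.
Proof.
move=> LL' f [n [a [n0 La e]]]; exists n, a; split => // i /La.
exact: ideal_powS.
Qed.

Lemma ideal_pow0 L x : ideal_pow L 0 x.
Proof.
rewrite -[x]mulr1; apply/ideal_genMl/ideal_gen_mem.
by exists (fun=> 0); split; [case | rewrite big_ord0].
Qed.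

Lemma ideal_pow1 L x : L x -> ideal_pow L 1 x.
Proof.
by move=> Lx; apply: ideal_gen_mem; exists (fun=> x); rewrite big_ord1.
Qed.

Lemma ideal_powM L (i j : nat) x y :
  ideal_pow L i x -> ideal_pow L j y -> ideal_pow L (i + j) (x * y).
Proof.
move=> Lx Ly; move: x Lx.
apply: ideal_gen_ind; first by rewrite mul0r; apply: ideal_gen0.
  by move=> ? ?; rewrite mulrDl; apply: ideal_genD.
move=> c _ [f [Lf ->]]; rewrite -mulrA; apply: ideal_genMl; move: y Ly.
apply: ideal_gen_ind; first by rewrite mulr0; apply: ideal_gen0.
  by move=> ? ?; rewrite mulrDr; apply: ideal_genD.
move=> d _ [g [Lg ->]]; rewrite mulrCA; apply/ideal_genMl/ideal_gen_mem.
exists (fun k : 'I_(i + j) => match split k with inl a => f a | inr b => g b end).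
split; first by move=> k; case: split.
rewrite big_split_ord /=; congr (_ * _); apply: eq_bigr => k _.
  by rewrite (unsplitK (inl k)).
by rewrite (unsplitK (inr k)).
Qed.

Lemma ideal_powX L n x : L x -> ideal_pow L n (x ^+ n).
Proof.
move=> Lx; elim: n => [|n IH]; first exact: ideal_pow0.
by rewrite exprS -add1n; apply: ideal_powM IH; apply: ideal_pow1.
Qed.

Lemma ideal_pow_prod L (J : finType) (c : J -> nat) (F : J -> A) :
  (forall k, ideal_pow L (c k) (F k)) ->
  ideal_pow L (\sum_k c k) (\prod_k F k).
Proof.
move=> LF; elim/big_rec2: _ => [|k x N _]; first exact: ideal_pow0.
exact: ideal_powM.
Qed.

Lemma ideal_pow_le L n p : (p <= n)%N -> ideal_pow L n `<=` ideal_pow L p.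
Proof.
move=> pn; apply: ideal_genS => x [f [Lf ->]].
move: f Lf; rewrite -(subnKC pn) => f Lf; rewrite big_split_ord /= mulrC.
by apply/ideal_genMl/ideal_gen_mem; exists (fun i => f (lshift _ i)).
Qed.

Lemma ideal_powMn L n p :
  ideal_pow L (p * n) `<=` ideal_pow (ideal_pow L n) p.
Proof.
elim: p => [|p IH] x; first by move=> _; apply: ideal_pow0.
rewrite mulSn; move: x; apply: ideal_genS => x [f [Lf ->]].
rewrite big_split_ord -add1n; apply: ideal_powM.
  apply/ideal_pow1/ideal_gen_mem.
  by exists (fun i => f (lshift _ i)).
apply/IH/ideal_gen_mem.
by exists (fun i => f (rshift _ i)).
Qed.

End IdealPowers.

(** * The Rees algebra and sums of integral elements *)

Section Rees.
Variables (A : comNzRingType) (L : set A).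

(** The Rees algebra A[LT]: f is integral over the ideal L exactly when f T is
    integral over this subring of A[T], which turns closure properties of the
    integral closure of an ideal into those of integral elements over a ring. *)
Definition rees : pred {poly A} := fun P => `[< forall i, ideal_pow L i P`_i >].

Lemma reesP (P : {poly A}) :
  reflect (forall i, ideal_pow L i P`_i) (P \in rees).
Proof. exact: asboolP. Qed.

Lemma rees_subring_closed : subring_closed rees.
Proof.
split.
- apply/reesP => i; rewrite coef1; case: i => [|i]; first exact: ideal_pow0.
  exact: ideal_gen0.
- move=> P Q /reesP LP /reesP LQ; apply/reesP => i.
  rewrite coefB; apply: ideal_genD; first exact: LP.
  exact/ideal_genN/LQ.
- move=> P Q /reesP LP /reesP LQ; apply/reesP => i.
  rewrite coefM; apply: ideal_gen_sum => j _.
  have ji : (j <= i)%N by rewrite -ltnS.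
  by have := ideal_powM (LP j) (LQ (i - j)%N); rewrite subnKC.
Qed.

Record rees_type := ReesElt {rees_val :> {poly A}; _ : rees_val \in rees}.

HB.instance Definition _ := [isSub for rees_val].
HB.instance Definition _ := [Choice of rees_type by <:].
HB.instance Definition _ :=
  GRing.SubChoice_isSubComNzRing.Build {poly A} rees rees_type
    rees_subring_closed.

Definition rees_integral (f : A) :=
  integralOver (val : rees_type -> {poly A}) (f *: 'X).

(** A monic equation for f T over the Rees algebra, read off in the degree in T
    of its leading term, is an equation of integral dependence of f on L. *)
Lemma rees_integral_closure f : rees_integral f -> integral_closure L f.
Proof.
case=> P monP; rewrite /root; set n := (size P).-1.
have sP : size P = n.+1 by rewrite /n prednK // size_poly_gt0 monic_neq0.
rewrite horner_poly sP => /eqP root0.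
have [n0|n0] := posnP n.
  move: root0; rewrite n0 big_ord1 expr0 mulr1.
  have -> : P`_0 = 1 by move: (monicP monP); rewrite lead_coefE -/n n0.
  by rewrite (rmorph1 val) => /eqP; rewrite oner_eq0.
exists n, (fun i => (val P`_(n - i))`_i); split => //.
  by move=> i _; move: (valP P`_(n - i)) => /reesP.
move/(congr1 (fun Q : {poly A} => Q`_n)): root0.
rewrite coef0 coef_sum => root0; rewrite -[RHS]root0.
rewrite big_ord_recr /= [RHS]addrC; congr (_ + _).
  have -> : rees_val P`_n = 1.
    have -> : P`_n = 1 by move: (monicP monP); rewrite lead_coefE.
    exact: (rmorph1 val).
  by rewrite mul1r exprZn coefZ coefXn eqxx mulr1.
rewrite big_add1 /= big_mkord (reindex_inj rev_ord_inj) /=.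
apply: eq_bigr => i _; have ltin := ltn_ord i.
have -> : (n - i.+1).+1 = (n - i)%N by rewrite subnSK.
rewrite subKn 1?ltnW // exprZn -scalerAr coefZ coefMXn.
by rewrite ltnNge ltnW //= mulrC.
Qed.

Lemma rees_integral_pow f p :
  (0 < p)%N -> ideal_pow L p (f ^+ p) -> rees_integral f.
Proof.
move=> p0 Lf.
have mem : f ^+ p *: 'X^p \in rees.
  apply/reesP => i; rewrite coefZ coefXn; case: eqP => [->|_].
    by rewrite mulr1.
  by rewrite mulr0; apply: ideal_gen0.
exists ('X^p - (ReesElt mem)%:P); first exact: monicXnsubC.
have -> : map_poly val ('X^p - (ReesElt mem)%:P) = 'X^p - (f ^+ p *: 'X^p)%:P.
  rewrite rmorphB; congr (_ - _); first exact: (map_polyXn val).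
  exact: (map_polyC val).
by rewrite /root !hornerE exprZn subrr.
Qed.

(** Each f_k T is integral over the Rees algebra, and integral elements over a
    ring are closed under addition. *)
Lemma integral_closure_sum (T : eqType) (r : seq T) (F : T -> A) :
  (forall k, k \in r ->
     exists2 p, (0 < p)%N & ideal_pow L p (F k ^+ p)) ->
  integral_closure L (\sum_(k <- r) F k).
Proof.
move=> HF; apply: rees_integral_closure.
rewrite /rees_integral scaler_suml big_seq; elim/big_ind: _.
- exact: integral0.
- by move=> x y; apply: integral_add.
- by move=> k /HF [p p0]; apply: rees_integral_pow p0.
Qed.

End Rees.

(** * Linear inequalities *)

Section Farkas.
Variable F : realFieldType.

(** Bartl's induction on the number of inequalities.  If the inequalities
    other than that of k0 do not imply the one of b, take a witness x0 of this.
    Either x0 satisfies that of k0 and the second alternative holds, or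
    subtracting from every functional the multiple of a k0 that makes it vanish
    at x0 reduces the question to the remaining inequalities. *)
Lemma farkas (T : finType) (J : eqType) (r : seq J) (a : J -> T -> F)
    (b : T -> F) : uniq r ->
  (exists2 lam : J -> F, forall k, 0 <= lam k
     & forall t, b t = \sum_(k <- r) lam k * a k t) \/
  (exists2 x : T -> F, {in r, forall k, \sum_t a k t * x t <= 0}
     & 0 < \sum_t b t * x t).
Proof.
elim: r a b => [|k0 r IH] a b /=.
  move=> _; have [b0|/existsP[t bt]] := boolP [forall t, b t == 0].
    left; exists (fun=> 0) => // t; rewrite big_nil.
    by move/forallP/(_ t)/eqP: b0.
  right; exists b => //; rewrite (bigD1 t) //=.
  apply: ltr_pwDl; first by rewrite -expr2 exprn_even_gt0.
  by apply: sumr_ge0 => i _; rewrite -expr2 sqr_ge0.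
case/andP=> k0r ur.
have [[lam lam0 lamb]|[x0 ax0 bx0]] := IH a b ur.
  left; exists (fun k => if k == k0 then 0 else lam k).
    by move=> k; case: ifP.
  move=> t; rewrite big_cons eqxx mul0r add0r lamb; apply: eq_big_seq => k kr.
  by case: eqP kr k0r => // -> ->.
have [a0|a0] := lerP (\sum_t a k0 t * x0 t) 0.
  right; exists x0 => // k; rewrite inE => /predU1P[->//|]; exact: ax0.
(* u - e u * a k0 vanishes at x0; by sumE its value at x is that of u at the
   projection of x, along x0, onto the kernel of a k0 *)
pose e u : F := (\sum_t u t * x0 t) / (\sum_t a k0 t * x0 t).
have sumE u x : \sum_t (u t - e u * a k0 t) * x t =
    \sum_t u t * (x t - (\sum_t a k0 t * x t) / (\sum_t a k0 t * x0 t) * x0 t).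
  transitivity (\sum_t u t * x t - e u * \sum_t a k0 t * x t).
    by rewrite mulr_sumr -sumrB; apply: eq_bigr => t _; ring.
  rewrite /e mulrAC -mulrA [in RHS](eq_bigr (fun t => u t * x t -
    u t * x0 t * ((\sum_t a k0 t * x t) / (\sum_t a k0 t * x0 t)))).
    by rewrite sumrB -mulr_suml.
  by move=> t _; ring.
have [[lam lam0 lamb]|[x ax bx]] :=
  IH (fun k t => a k t - e (a k) * a k0 t) (fun t => b t - e b * a k0 t) ur.
- left; exists (fun k => if k == k0 then e b - \sum_(k <- r) lam k * e (a k)
                         else lam k).
    move=> k; case: ifP => // _; rewrite subr_ge0.
    apply: (@le_trans _ _ 0); last by rewrite divr_ge0 // ltW.
    rewrite big_seq; apply: sumr_le0 => j jr; apply: mulr_ge0_le0 => //.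
    by rewrite pmulr_lle0 ?invr_gt0 // ax0.
  move=> t; rewrite big_cons eqxx.
  have -> : \sum_(j <- r) (if j == k0 then e b - \sum_(k <- r) lam k * e (a k)
       else lam j) * a j t = \sum_(j <- r) lam j * a j t.
    apply: eq_big_seq => j jr; case: eqP => // jk0.
    by rewrite -jk0 jr in k0r.
  rewrite -[LHS](subrK (e b * a k0 t)) lamb.
  rewrite (eq_bigr (fun k => lam k * a k t - lam k * e (a k) * a k0 t)).
    by rewrite sumrB -mulr_suml; ring.
  by move=> k _; ring.
- right; exists (fun t => x t -
    (\sum_t a k0 t * x t) / (\sum_t a k0 t * x0 t) * x0 t).
    move=> k; rewrite inE => /predU1P[->|kr]; last by rewrite -sumE ax.
    rewrite -sumE big1 // => t _.
    by rewrite /e divff ?gt_eqF // mul1r subrr mul0r.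
  by rewrite -sumE.
Qed.

(** Farkas' lemma for the vector (x, 1) and the generators (v k, 1) and
    (e_j, 0): the last coordinate forces the coefficients of the v k to have
    sum 1, and the unit vectors provide the slack in the inequalities. *)
Lemma convex_separation (s q : nat) (v : 'I_q -> 'I_s -> F) (x : 'I_s -> F) :
  (exists lam : 'I_q -> F,
     [/\ forall k, 0 <= lam k, \sum_k lam k = 1
       & forall i, \sum_k lam k * v k i <= x i]) \/
  (exists (w : 'I_s -> F) (c : F),
     [/\ forall i, 0 <= w i, forall k, c <= \sum_i v k i * w i
       & \sum_i x i * w i < c]).
Proof.
pose a (k : 'I_q + 'I_s) (t : 'I_s + unit) : F :=
  match k, t with
  | inl k, inl i => v k i
  | inl _, inr _ => 1
  | inr j, inl i => (i == j)%:R
  | inr _, inr _ => 0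
  end.
pose b (t : 'I_s + unit) : F := if t is inl i then x i else 1.
have [[lam lam0 lamb]|[y ay yb]] := farkas a b (index_enum_uniq _).
  left; exists (lam \o inl); split => [k||i] /=; first exact: lam0.
    have := lamb (inr tt); rewrite big_sumType /= [X in _ + X]big1 ?addr0.
      by move=> ->; apply: eq_bigr => k _; rewrite mulr1.
    by move=> k _; rewrite mulr0.
  have := lamb (inl i); rewrite big_sumType /= => ->.
  by rewrite lerDl; apply: sumr_ge0 => k _; rewrite mulr_ge0 ?ler0n.
right; exists (fun i => - y (inl i)), (y (inr tt)); split => [i|k|].
- have := ay (inr i) (mem_index_enum _); rewrite big_sumType /=.
  rewrite [X in _ + X]big1 ?addr0; last by move=> ? _; rewrite mul0r.
  rewrite (bigD1 i) //= eqxx mul1r big1 ?addr0 ?oppr_ge0 //.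
  by move=> j /negPf ->; rewrite mul0r.
- have := ay (inl k) (mem_index_enum _); rewrite big_sumType /=.
  rewrite (big_pred1 tt) /=; last by case.
  rewrite mul1r -subr_ge0 opprD => ?.
  rewrite -subr_ge0 (eq_bigr (fun i => - (v k i * y (inl i)))).
    by rewrite sumrN; lra.
  by move=> i _; rewrite mulrN.
- move: yb; rewrite big_sumType /= (big_pred1 tt) /=; last by case.
  rewrite mul1r (eq_bigr (fun i => - (x i * - y (inl i)))).
    by rewrite sumrN; lra.
  by move=> i _; ring.
Qed.

End Farkas.

(** Feasibility of a rational linear system over R implies feasibility over
    the rationals: by duality over the rationals, infeasibility has a rational
    certificate, which would also refute the solution over R. *)
Lemma rational_convex_combination (R : realFieldType) (s q : nat)
    (v : 'I_q -> 'I_s -> nat) (x : 'I_s -> rat) (lam : 'I_q -> R) :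
  (forall k, 0 <= lam k) -> \sum_k lam k = 1 ->
  (forall i, \sum_k lam k * (v k i)%:R <= ratr (x i)) ->
  exists mu : 'I_q -> rat,
    [/\ forall k, 0 <= mu k, \sum_k mu k = 1
      & forall i, \sum_k mu k * (v k i)%:R <= x i].
Proof.
move=> lam0 lam1 lamx.
have [//|[w [c [w0 cw xw]]]] := convex_separation (fun k i => (v k i)%:R) x.
exfalso; move: xw; rewrite -(ltr_rat R) ltNge => /negP; apply.
rewrite -[leLHS]mul1r -lam1 mulr_suml rmorph_sum /=.
apply: (@le_trans _ _ (\sum_k lam k * \sum_i (v k i)%:R * ratr (w i))).
  apply: ler_sum => k _; apply: ler_wpM2l => //.
  move: (cw k); rewrite -(ler_rat R) rmorph_sum /= => /le_trans; apply.
  by apply: ler_sum => i _; rewrite rmorphM /= ratr_nat.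
rewrite (eq_bigr (fun k => \sum_i lam k * ((v k i)%:R * ratr (w i)))); last first.
  by move=> k _; rewrite mulr_sumr.
rewrite exchange_big /=; apply: ler_sum => i _.
rewrite rmorphM /=.
apply: (@le_trans _ _ ((\sum_k lam k * (v k i)%:R) * ratr (w i))).
  by rewrite mulr_suml; apply: ler_sum => k _; rewrite mulrA.
by apply: ler_wpM2r; rewrite ?ler0q.
Qed.

Lemma clear_denominators (q : nat) (mu : 'I_q -> rat) :
  (forall k, 0 <= mu k) ->
  exists (p : nat) (d : 'I_q -> nat),
    (0 < p)%N /\ forall k, (d k)%:R = p%:R * mu k.
Proof.
move=> mu0.
exists (\prod_k `|denq (mu k)|)%N,
  (fun k => (`|numq (mu k)| * \prod_(j | j != k) `|denq (mu j)|)%N).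
split=> [|k]; first by rewrite prodn_gt0 // => k; rewrite absz_gt0 denq_neq0.
rewrite [in RHS](bigD1 k) //= !natrM mulrAC; congr (_ * _).
rewrite !natr_absz ger0_norm ?numq_ge0 // gtr0_norm ?denq_gt0 //.
by rewrite mulrC numqE mulrC.
Qed.

(** * Monomials in the integral closure *)

Section Monomials.
Variables (K : fieldType) (s : nat).
Implicit Types (m : 'X_{1..s}) (P Q : set 'X_{1..s}) (f g : {mpoly K[s]}).
Implicit Types (L : set {mpoly K[s]}).

Definition supported_in P : set {mpoly K[s]} :=
  [set f | forall m, m \in msupp f -> P m].

Lemma supported_in0 P : supported_in P 0.
Proof. by move=> m; rewrite msupp0. Qed.

Lemma supported_inD P f g :
  supported_in P f -> supported_in P g -> supported_in P (f + g).
Proof.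
by move=> Pf Pg m /msuppD_le; rewrite mem_cat => /orP[/Pf|/Pg].
Qed.

Lemma supported_inN P f : supported_in P f -> supported_in P (- f).
Proof. by move=> Pf m; rewrite (perm_mem (msuppN f)); apply: Pf. Qed.

Lemma supported_inM (P Q U : set 'X_{1..s}) f g :
  (forall m m', P m -> Q m' -> U (m + m')%MM) ->
  supported_in P f -> supported_in Q g -> supported_in U (f * g).
Proof.
move=> PQU Pf Qg m /msuppM_le /allpairsP[[m1 m2] /= [/Pf P1 /Qg Q2 ->]].
exact: PQU.
Qed.

Lemma supported_in_ideal P (G : set {mpoly K[s]}) :
  (forall m m', P m -> P (m + m')%MM) ->
  G `<=` supported_in P -> ideal_gen G `<=` supported_in P.
Proof.
move=> Pup GP; apply: ideal_gen_ind; first exact: supported_in0.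
  by move=> f g; apply: supported_inD.
move=> c g /GP; apply: (@supported_inM setT P P) => // m m' _.
by rewrite addmC; apply: Pup.
Qed.

Lemma monomials_ideal G f :
  (forall m, m \in msupp f -> ideal_gen G 'X_[K, m]) -> ideal_gen G f.
Proof.
move=> Gf; rewrite [f]mpolyE; apply: ideal_gen_sum => m /Gf.
by rewrite -mul_mpolyC; apply: ideal_genMl.
Qed.

Lemma monomials_integral_closure L f :
  (forall m, m \in msupp f ->
     exists2 p, (0 < p)%N & ideal_pow L p 'X_[K, m *+ p]) ->
  integral_closure L f.
Proof.
move=> Lf; rewrite [f]mpolyE; apply: integral_closure_sum => m /Lf[p p0 Lm].
exists p => //; rewrite -mul_mpolyC exprMn mpolyXn.
exact: ideal_genMl.
Qed.

(** The product of the (t^v_k)^c_k divides t^m. *)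
Lemma ideal_pow_monomial L (J : finType) (v : J -> 'X_{1..s}) (c : J -> nat)
    (N : nat) m :
  (forall k, (0 < c k)%N -> L 'X_[v k]) -> (N <= \sum_k c k)%N ->
  (forall i, (\sum_k c k * v k i <= m i)%N) ->
  ideal_pow L N 'X_[m].
Proof.
move=> Lv Nc vm; apply: (ideal_pow_le Nc).
have le : ((\sum_k v k *+ c k)%MM <= m)%MM.
  apply/mnm_lepP => i; rewrite mnm_sumE; apply: leq_trans (vm i).
  by apply: leq_sum => k _; rewrite mulmnE mulnC.
rewrite -(submK le) mpolyXD -mprodXnE; apply/ideal_genMl/ideal_pow_prod => k.
have [->|ck] := posnP (c k); first exact: ideal_pow0.
exact/ideal_powX/Lv.
Qed.

End Monomials.

Section Weights.
Variables (R : realType) (K : fieldType) (s : nat).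
Implicit Types (m : 'X_{1..s}) (w : 'rV[R]_s) (f g : {mpoly K[s]}).
Implicit Types (L : set {mpoly K[s]}).

Definition weight w m : R := dotp (expvec R m) w.

Lemma weightE w m : weight w m = \sum_i (m i)%:R * w 0 i.
Proof. by apply: eq_bigr => i _; rewrite mxE. Qed.

Lemma weight0 w : weight w 0%MM = 0.
Proof. by rewrite weightE big1 // => i _; rewrite mnm0E mul0r. Qed.

Lemma weightD w m m' : weight w (m + m')%MM = weight w m + weight w m'.
Proof.
rewrite !weightE -big_split; apply: eq_bigr => i _ /=.
by rewrite mnmDE natrD mulrDl.
Qed.

Lemma weight_ge0 w m : nonneg_orthant w -> 0 <= weight w m.
Proof.
by move=> w0; rewrite weightE sumr_ge0 // => i _; rewrite mulr_ge0 // w0.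
Qed.

Definition weight_ge w (c : R) : set {mpoly K[s]} :=
  supported_in [set m | c <= weight w m].

Lemma weight_geX w c f n : weight_ge w c f -> weight_ge w (n%:R * c) (f ^+ n).
Proof.
move=> cf; elim: n => [|n IH].
  rewrite expr0 mul0r => m; rewrite -mpolyX0 => /mem_msuppXP <- /=.
  by rewrite weight0.
rewrite exprS; apply: (supported_inM _ cf IH) => m m' /=.
by rewrite weightD -natr1 mulrDl mul1r addrC; apply: lerD.
Qed.

Lemma weight_ge_ideal w c (G : set {mpoly K[s]}) : nonneg_orthant w ->
  G `<=` weight_ge w c -> ideal_gen G `<=` weight_ge w c.
Proof.
move=> w0; apply: supported_in_ideal => m m' /= cm.
by rewrite weightD ler_wpDr // weight_ge0.
Qed.

Lemma weight_ge_pow w c L n : nonneg_orthant w ->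
  L `<=` weight_ge w c -> ideal_pow L n `<=` weight_ge w (n%:R * c).
Proof.
move=> w0 Lc; apply: weight_ge_ideal => // _ [f [Lf ->]].
elim: n f Lf => [|n IH] f Lf.
  rewrite big_ord0 mul0r => m; rewrite -mpolyX0 => /mem_msuppXP <- /=.
  by rewrite weight0.
rewrite big_ord_recl.
apply: (supported_inM _ (Lc _ (Lf ord0)) (IH _ (fun i => Lf (lift ord0 i)))).
move=> m m' /=; rewrite weightD -natr1 mulrDl mul1r addrC; exact: lerD.
Qed.

(** Suppose that the least weight d of a monomial of f were below c, and let f0
    be the initial form of f, the part of weight d.  In an equation of integral
    dependence of degree n, the terms a_i f^(n - i) with i >= 1 have order at
    least i c + (n - i) d > n d, and f^n - f0^n has order > n d too.  So the form
    f0^n of weight n d vanishes, while f0 is a nonzero element of a domain. *)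
Lemma weight_ge_closure w c L : nonneg_orthant w ->
  L `<=` weight_ge w c -> integral_closure L `<=` weight_ge w c.
Proof.
move=> w0 Lc f [n [a [n0 La eqf]]] m1 m1f.
rewrite /= leNgt; apply/negP => m1c.
have [m0 m0f m0min] : exists2 m0, m0 \in msupp f &
    forall m, m \in msupp f -> weight w m0 <= weight w m.
  have : msupp f != [::] by case: (msupp f) m1f.
  elim: (msupp f) => // m r IH _; have [->|/IH [m0 m0r m0min]] := eqVneq r [::].
    by exists m; rewrite ?mem_head // => ?; rewrite mem_seq1 => /eqP ->.
  have [le|lt] := lerP (weight w m) (weight w m0).
    exists m; rewrite ?mem_head // => k; rewrite inE => /predU1P[-> //|/m0min].
    exact: le_trans.
  exists m0; first by rewrite inE m0r orbT.
  by move=> k; rewrite inE => /predU1P[->|/m0min //]; apply: ltW.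
pose d := weight w m0.
have dc : d < c by apply: le_lt_trans m1c; apply: m0min.
have df : weight_ge w d f by move=> m /m0min.
pose f0 := \sum_(m <- msupp f | weight w m == d) f@_m *: 'X_[K, m].
pose f1 := \sum_(m <- msupp f | weight w m != d) f@_m *: 'X_[K, m].
have f01 : f = f0 + f1 by rewrite [LHS]mpolyE (bigID (fun m => weight w m == d)).
have suppZX (k : K) m : supported_in [set m' | m' = m] (k *: 'X_[K, m]).
  by move=> m' /msuppZ_le /mem_msuppXP.
have f0d : supported_in [set m | weight w m = d] f0.
  rewrite /f0; elim/big_ind: _ => //; first exact: supported_in0.
    by move=> ? ?; apply: supported_inD.
  by move=> m /eqP md ? /suppZX ->.
have f1d : supported_in [set m | d < weight w m] f1.
  rewrite /f1 big_seq_cond; elim/big_ind: _ => //; first exact: supported_in0.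
    by move=> ? ?; apply: supported_inD.
  by move=> m /andP[/m0min dm md] ? /suppZX ->; rewrite /= lt_neqAle eq_sym md.
have f0X k : supported_in [set m | weight w m = k%:R * d] (f0 ^+ k).
  elim: k => [|k IH].
    by rewrite expr0 mul0r => m; rewrite -mpolyX0 => /mem_msuppXP <-; apply: weight0.
  rewrite exprS; apply: supported_inM f0d IH => m m' /= dm dm'.
  by rewrite weightD dm dm' -natr1; ring.
have fX k : supported_in [set m | k%:R * d < weight w m] (f ^+ k - f0 ^+ k).
  elim: k => [|k IH]; first by rewrite subrr; apply: supported_in0.
  have -> : f ^+ k.+1 - f0 ^+ k.+1 = f0 * (f ^+ k - f0 ^+ k) + f1 * f ^+ k.
    by rewrite !exprS {1}f01; ring.
  apply: supported_inD.
    apply: supported_inM f0d IH => m m' /= dm dm'.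
    by rewrite weightD dm -natr1; lra.
  apply: supported_inM f1d (weight_geX (n := k) df) => m m' /= dm dm'.
  by rewrite weightD -natr1; lra.
have : f0 ^+ n != 0.
  apply: expf_neq0; apply/eqP => f00.
  have : m0 \in msupp f1 by move: m0f; rewrite {1}f01 f00 add0r.
  by move/f1d; rewrite /= ltxx.
rewrite -msupp_eq0; case E : (msupp _) => [//|m r] _.
have mn : m \in msupp (f0 ^+ n) by rewrite E mem_head.
suff /(_ _ mn) : supported_in [set m | n%:R * d < weight w m] (f0 ^+ n).
  by rewrite /= (f0X _ _ mn) ltxx.
have -> : f0 ^+ n = - ((f ^+ n - f0 ^+ n) +
     \sum_(1 <= i < n.+1) a i * f ^+ (n - i)).
  by rewrite addrAC eqf sub0r opprK.
apply: supported_inN; apply: supported_inD; first exact: fX.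
rewrite big_seq.
elim/big_ind: _ => [||i]; first exact: supported_in0.
  by move=> ? ?; apply: supported_inD.
rewrite mem_index_iota ltnS => /andP[i1 ile].
have aw := weight_ge_pow w0 Lc (La i (introT andP (conj i1 ile))).
apply: supported_inM aw (weight_geX (n := n - i) df) => m2 m3 /= h2 h3.
rewrite weightD -{1}(subnKC ile) natrD mulrDl.
apply: ltr_leD => //; apply: lt_le_trans h2.
by rewrite ltr_pM2l // ltr0n.
Qed.

End Weights.

(** * Minimal monomial generators of an intersection of irreducible ideals *)

Section IrreducibleDecomposition.
Variables (R : realType) (K : fieldType) (s : nat).
Implicit Types (b m : 'X_{1..s}) (f : {mpoly K[s]}).

Lemma irr_idealE b f : irr_ideal K b f <->
  forall m, m \in msupp f -> exists i, (1 <= b i <= m i)%N.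
Proof.
split.
  apply: (@supported_in_ideal _ _ [set m | exists i, (1 <= b i <= m i)%N]).
    move=> m m' [i /andP[b1 bm]]; exists i; rewrite b1 mnmDE /=.
    exact: leq_trans bm (leq_addr _ _).
  move=> _ [i [b1 ->]]; rewrite mpolyXn => m /mem_msuppXP <-.
  by exists i; rewrite b1 mulmnE mnm1E eqxx mul1n /=.
move=> bf; apply: monomials_ideal => m /bf[i /andP[b1 bm]].
have le : (U_(i) *+ b i <= m)%MM.
  apply/mnm_lepP => j; rewrite mulmnE mnm1E; case: eqP => [<-|_].
    by rewrite mul1n.
  by rewrite mul0n.
rewrite -(submK le) mpolyXD -mpolyXn; apply/ideal_genMl/ideal_gen_mem.
by exists i.
Qed.

(** A finite generating family with the least number of elements is minimal. *)
Lemma minimal_generators_of_finite (I : set {mpoly K[s]})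
    (r : seq 'X_{1..s}) : I = monomial_gen [set` r] ->
  exists (q : nat) (v : 'I_q -> 'X_{1..s}), minimally_generated I v.
Proof.
move=> Ir.
have ex : exists q,
    `[< exists v : 'I_q -> 'X_{1..s}, I = monomial_gen (range v) >].
  exists (size r); apply/asboolP; exists (tnth (in_tuple r)); rewrite Ir.
  congr monomial_gen; apply/seteqP; split => m /=.
    by move/(tnthP (in_tuple r)) => [k ->]; exists k.
  by move=> [k _ <-]; apply: mem_tnth.
case: (ex_minnP ex) => q /asboolP[v Iv] qmin; exists q, v; split => //.
case: q v Iv qmin => [|q] v Iv qmin j Ij; first by have := ltn_ord j.
suff /qmin : `[< exists v : 'I_q -> 'X_{1..s}, I = monomial_gen (range v) >].
  by rewrite ltnn.
apply/asboolP; exists (v \o lift j); rewrite Ij; congr monomial_gen.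
apply/seteqP; split => m /=.
  move=> [k /= /eqP kj <-]; move: kj; rewrite eq_sym => /unlift_some[k' -> _].
  by exists k'.
move=> [k _ <-]; exists (lift j k) => //= /eqP.
by rewrite eq_sym (negPf (neq_lift _ _)).
Qed.

(** Exponents larger than all those of the alpha j can be lowered to their
    maximum D, so that the finitely many monomials of I with exponents at most D
    generate I. *)
Lemma minimal_generators_exist (I : set {mpoly K[s]}) (n : nat)
    (alpha : 'I_n -> 'X_{1..s}) : I = \bigcap_j irr_ideal K (alpha j) ->
  exists (q : nat) (v : 'I_q -> 'X_{1..s}), minimally_generated I v.
Proof.
move=> Ialpha; pose D := (\max_j \max_i alpha j i)%N.
have alphaD j i : (alpha j i <= D)%N.
  apply: leq_trans (leq_bigmax j); exact: (leq_bigmax i).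
have memI f : I f <->
    forall m, m \in msupp f -> forall j, exists i, (1 <= alpha j i <= m i)%N.
  rewrite Ialpha; split=> [If m mf j|If j _].
    by have /irr_idealE := If j Logic.I; apply.
  by apply/irr_idealE => m /If.
pose box := [seq [multinom (f i : nat) | i < s] | f : {ffun 'I_s -> 'I_D.+1}].
apply: (@minimal_generators_of_finite I [seq b <- box | `[< I 'X_[b] >]]).
apply/seteqP; split => f.
  move/memI => If; apply: monomials_ideal => m /If {}If.
  pose b : 'X_{1..s} := [multinom minn (m i) D | i < s].
  have le : (b <= m)%MM by apply/mnm_lepP => i; rewrite mnmE geq_minl.
  rewrite -(submK le) mpolyXD; apply/ideal_genMl/ideal_gen_mem.
  exists b => //=; rewrite mem_filter; apply/andP; split.
    apply/asboolP/memI => _ /mem_msuppXP <- j; have [i /andP[a1 am]] := If j.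
    by exists i; rewrite a1 mnmE leq_min am alphaD.
  apply/mapP; exists [ffun i => inord (minn (m i) D)]; first by rewrite mem_enum.
  by apply/mnmP => i; rewrite !mnmE ffunE inordK // ltnS geq_minr.
have Iideal j : @monomial_gen K s [set` [seq b <- box | `[< I 'X_[b] >]]]
    `<=` irr_ideal K (alpha j).
  apply: ideal_genS => _ [b /= + <-].
  by rewrite mem_filter => /andP[/asboolP + _]; rewrite Ialpha; apply.
by move=> If; rewrite Ialpha => j _; apply: Iideal.
Qed.

Lemma invvec_ge0 b : nonneg_orthant (invvec R b).
Proof. by move=> i; rewrite mxE; case: ifP; rewrite ?invr_ge0. Qed.

Lemma irr_ideal_weight b : irr_ideal K b `<=` weight_ge (invvec R b) 1.
Proof.
apply: weight_ge_ideal (@invvec_ge0 b) _ => _ [i [b1 ->]].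
rewrite mpolyXn => _ /mem_msuppXP <- /=; rewrite weightE (bigD1 i) //=.
rewrite mulmnE mnm1E eqxx mul1n mxE b1 divff ?lerDl; last first.
  by rewrite pnatr_eq0 -lt0n.
apply: sumr_ge0 => j _; apply: mulr_ge0 => //; exact: invvec_ge0.
Qed.

Lemma monomial_gen_weight (q : nat) (v : 'I_q -> 'X_{1..s}) (w : 'rV[R]_s) c :
  nonneg_orthant w -> (forall k, c <= weight w (v k)) ->
  @monomial_gen K s (range v) `<=` weight_ge w c.
Proof.
move=> w0 cv; apply: weight_ge_ideal => // _ [_ [k _ <-] <-] m.
by move/mem_msuppXP <-; apply: cv.
Qed.

(** With p the product of the nonzero b_i, the p-th power of t^m is, up to a
    factor, the product of the powers c_i = p m_i / b_i of the generators
    t_i^b_i, and the sum of the c_i is p <m, b^-1> >= p n. *)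
Lemma irr_ideal_closure_monomial b m (n : nat) :
  n%:R <= weight (invvec R b) m ->
  integral_closure (ideal_pow (irr_ideal K b) n) 'X_[K, m].
Proof.
move=> nm.
(* b' i is the factor of p for i: 1 if b i = 0 *)
pose b' i := maxn 1 (b i); pose p := (\prod_i b' i)%N.
have p0 : (0 < p)%N by rewrite prodn_gt0 // => i; rewrite leq_max.
apply: monomials_integral_closure => _ /mem_msuppXP <-; exists p => //.
apply: ideal_powMn.
pose c i := if (1 <= b i)%N then (m i * \prod_(j | j != i) b' j)%N else 0%N.
have bc i : (c i * b i <= m i * p)%N.
  rewrite /c; case: ifP => // bi; rewrite -mulnA leq_mul2l; apply/orP; right.
  by rewrite /p [leqRHS](bigD1 i) //= mulnC leq_mul2r /b' leq_max leqnn !orbT.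
apply: (@ideal_pow_monomial _ _ _ _ (fun i => U_(i) *+ b i)%MM c).
- move=> i; rewrite /c; case: ifP => // bi _; apply: ideal_gen_mem.
  by exists i; rewrite mpolyXn.
- rewrite -(ler_nat R) natr_sum natrM.
  apply: (@le_trans _ _ (p%:R * weight (invvec R b) m)).
    by apply: ler_wpM2l.
  rewrite weightE mulr_sumr; apply: ler_sum => i _; rewrite mxE /c.
  case: ifP => bi; last by rewrite !mulr0.
  rewrite /p (bigD1 i) //= /b' (maxn_idPr bi) !natrM.
  have : (b i)%:R != 0 :> R by rewrite pnatr_eq0 -lt0n.
  by move=> bi0; rewrite le_eqVlt; apply/orP; left; apply/eqP; field.
- move=> i; rewrite mulmnE (bigD1 i) //= mulmnE mnm1E eqxx mul1n.
  rewrite big1 ?addn0 // => j /negPf ji.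
  by rewrite mulmnE mnm1E ji mul0n muln0.
Qed.

End IrreducibleDecomposition.

(** * The two polyhedra *)

Section Polyhedra.
Variables (R : realType) (K : fieldType) (s : nat) (I : set {mpoly K[s]}).

Lemma dotpE (x y : 'rV[R]_s) : dotp x y = \sum_i x 0 i * y 0 i.
Proof. by []. Qed.

(** Choose rational coefficients mu_k for the generators v_k, with common
    denominator p: then p m is at least the sum of the n (p mu_k) v_k, and the
    integers n (p mu_k) have sum n p, so that t^(p m) lies in I^(n p). *)
Lemma Newton_closure_monomial (n : nat) (m : 'X_{1..s}) : (0 < n)%N ->
  Newton_polyhedron R I (n%:R^-1 *: expvec R m) ->
  exists2 p, (0 < p)%N & ideal_pow (ideal_pow I n) p 'X_[K, m *+ p].
Proof.
move=> n0 [q [v [[Iv _] [y [z [y0 [lam [lam0 lam1 zE]] xE]]]]]].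
have nR0 : n%:R != 0 :> rat by rewrite pnatr_eq0 -lt0n.
have [k|||mu [mu0 mu1 mux]] := @rational_convex_combination R s q (fun k i => v k i)
    (fun i => (m i)%:R / n%:R) lam.
- exact: lam0.
- exact: lam1.
- move=> i; rewrite fmorph_div /= !ratr_nat.
  move/rowP/(_ i): xE; rewrite !mxE mulrC => ->.
  rewrite zE summxE addrC -subr_ge0.
  rewrite (eq_bigr (fun k => lam k * (v k i)%:R)); last by move=> k _; rewrite !mxE.
  by rewrite addrAC subrr add0r; apply: y0.
have [p [d [p0 dE]]] := clear_denominators mu0.
exists p => //; apply: ideal_powMn.
apply: (@ideal_pow_monomial _ _ _ _ v (fun k => d k * n)%N).
- move=> k _; rewrite Iv; apply: ideal_gen_mem; exists (v k) => //; exists k.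
- rewrite -big_distrl /= leq_mul2r; apply/orP; right.
  rewrite -(ler_nat rat) natr_sum (eq_bigr _ (fun k _ => dE k)).
  by rewrite -mulr_sumr mu1 mulr1.
- move=> i; rewrite mulmnE -(ler_nat rat) natr_sum natrM.
  rewrite (eq_bigr (fun k => p%:R * n%:R * (mu k * (v k i)%:R))); last first.
    by move=> k _; rewrite !natrM dE; ring.
  rewrite -mulr_sumr; apply: le_trans (ler_wpM2l _ (mux i)) _.
    by rewrite mulr_ge0.
  have -> : p%:R * n%:R * ((m i)%:R / n%:R) = (m i)%:R * p%:R :> rat.
    by field.
  by [].
Qed.

(** Each generator v_k of I lies in q_j, hence has weight >= 1 for
    alpha_j^-1; so has any convex combination of the v_k, and adding a
    nonnegative vector does not decrease the weight. *)
Lemma Newton_polyhedron_sub (n : nat) (alpha : 'I_n -> 'X_{1..s}) :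
  (forall j, I `<=` irr_ideal K (alpha j)) ->
  Newton_polyhedron R I `<=` irreducible_polyhedron R alpha.
Proof.
move=> Iirr x [q [v [[Iv _] [y [z [y0 [lam [lam0 lam1 zE]] xE]]]]]].
have zi i : z 0 i = \sum_k lam k * (v k i)%:R.
  by rewrite zE summxE; apply: eq_bigr => k _; rewrite !mxE.
split=> [i|j].
  rewrite xE mxE zi; apply: addr_ge0; first exact: y0.
  by apply: sumr_ge0 => k _; apply: mulr_ge0.
have vj k : 1 <= weight (invvec R (alpha j)) (v k).
  suff /irr_ideal_weight /(_ (v k)) : irr_ideal K (alpha j) 'X_[v k].
    by apply; rewrite msuppX mem_head.
  by apply: Iirr; rewrite Iv; apply: ideal_gen_mem; exists (v k) => //; exists k.
have -> : dotp x (invvec R (alpha j)) = dotp y (invvec R (alpha j)) +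
    \sum_k lam k * weight (invvec R (alpha j)) (v k).
  under [in RHS]eq_bigr do rewrite weightE mulr_sumr.
  rewrite exchange_big /= -big_split; apply: eq_bigr => i _ /=.
  rewrite xE mxE zi mulrDl mulr_suml; congr (_ + _).
  by apply: eq_bigr => k _; rewrite mulrA.
apply: ler_wpDl.
  by apply: sumr_ge0 => i _; rewrite mulr_ge0 ?y0 // invvec_ge0.
rewrite -lam1; apply: ler_sum => k _; rewrite -[leLHS]mulr1.
exact: ler_wpM2l.
Qed.

(** Strict separation of x from the polyhedron by w >= 0 leaves a margin
    c - <x, w>.  Rounding n x up to integers adds at most the sum of the w_i,
    which n times the margin exceeds for n large. *)
Lemma Newton_polyhedron_rounding (q : nat) (v : 'I_q -> 'X_{1..s})
    (x : 'rV[R]_s) : minimally_generated I v -> nonneg_orthant x ->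
  ~ Newton_polyhedron R I x ->
  exists (n : nat) (m : 'X_{1..s}) (w : 'rV[R]_s) (c : R),
    [/\ (0 < n)%N, nonneg_orthant w, forall k, c <= weight w (v k),
        forall i, n%:R * x 0 i <= (m i)%:R & weight w m < n%:R * c].
Proof.
move=> Iv x0 xN.
have [[lam [lam0 lam1 lamx]]|[w [c [w0 cw xw]]]] :=
  convex_separation (fun k i => (v k i)%:R) (fun i => x 0 i).
  exfalso; apply: xN; exists q, v; split=> //.
  exists (x - \sum_k lam k *: expvec R (v k)), (\sum_k lam k *: expvec R (v k)).
  split; last by rewrite subrK.
    move=> i; rewrite !mxE summxE subr_ge0; apply: le_trans (lamx i).
    by rewrite le_eqVlt; apply/orP; left; apply/eqP/eq_bigr => k _; rewrite !mxE.
  by exists lam.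
pose W : 'rV[R]_s := \row_i w i.
pose n := (Num.truncn ((\sum_i w i) / (c - \sum_i x 0 i * w i))).+1.
have nlt : (\sum_i w i) / (c - \sum_i x 0 i * w i) < n%:R by exact: truncnS_gt.
exists n, [multinom (Num.truncn (n%:R * x 0 i)%R).+1 | i < s], W, c; split => //.
- by move=> i; rewrite mxE.
- move=> k; rewrite weightE; apply: le_trans (cw k) _.
  by rewrite le_eqVlt; apply/orP; left; apply/eqP/eq_bigr => i _; rewrite mxE.
- by move=> i; rewrite mnmE; apply/ltW/truncnS_gt.
rewrite weightE; apply: (@le_lt_trans _ _ (\sum_i (n%:R * (x 0 i * w i) + w i))).
  apply: ler_sum => i _; rewrite !mxE mnmE -natr1 mulrDl mul1r mulrA lerD2r.
  by apply: ler_wpM2r => //; rewrite truncn_le // mulr_ge0 // x0.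
rewrite big_split -mulr_sumr /= addrC -ltrBrDr -mulrBr.
by rewrite -ltr_pdivrMr // subr_gt0.
Qed.

End Polyhedra.

Theorem theorem7p6 (R : realType) (K : fieldType) (s : nat)
    (I : set {mpoly K[s]}) (m : nat) (alpha : 'I_m -> 'X_{1..s})
    (hI : monomial_ideal I) (hdec : irreducible_decomposition I alpha) :
  Newton_polyhedron R I = irreducible_polyhedron R alpha <->
  (forall n : nat, (1 <= n)%N ->
     integral_closure (ideal_pow I n) =
     \bigcap_j integral_closure (ideal_pow (irr_ideal K (alpha j)) n)).
Proof.
case: hdec => _ Ialpha _.
have Iirr j : I `<=` irr_ideal K (alpha j).
  by rewrite Ialpha => f; apply.
split=> [NPIP n n0|closures].
  apply/seteqP; split=> [f fI j _|f fq].
    by move: fI; apply/integral_closureS/ideal_powS.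
  apply: monomials_integral_closure => a af.
  apply: (Newton_closure_monomial (R := R)) => //; rewrite NPIP.
  split=> [i|j].
    by rewrite !mxE mulr_ge0 // invr_ge0.
  have := weight_ge_closure (@invvec_ge0 R s (alpha j)) (weight_ge_pow
    (n := n) (@invvec_ge0 R s (alpha j)) (@irr_ideal_weight R K s (alpha j)))
    (fq j Logic.I) af.
  rewrite /= mulr1 weightE => na.
  rewrite dotpE (eq_bigr (fun i => n%:R^-1 * ((a i)%:R * invvec R (alpha j) 0 i))).
    by rewrite -mulr_sumr mulrC ler_pdivlMr ?mul1r // ltr0n.
  by move=> i _; rewrite !mxE mulrA.
apply/seteqP; split; first exact: Newton_polyhedron_sub.
move=> x [x0 x1]; apply: contrapT => xN.
have [q [v Iv]] := minimal_generators_exist Ialpha.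
have [n [a [w [c [n0 w0 cw xa aw]]]]] := Newton_polyhedron_rounding Iv x0 xN.
have : integral_closure (ideal_pow I n) 'X_[a].
  rewrite closures // => j _; apply: (@irr_ideal_closure_monomial R).
  apply: (@le_trans _ _ (n%:R * dotp x (invvec R (alpha j)))).
    by rewrite -[leLHS]mulr1; apply: ler_wpM2l.
  rewrite weightE dotpE mulr_sumr; apply: ler_sum => i _; rewrite mulrA.
  by apply: ler_wpM2r => //; apply: invvec_ge0.
have Ic : I `<=` weight_ge w c by rewrite (proj1 Iv); apply: monomial_gen_weight.
move/(weight_ge_closure w0 (weight_ge_pow w0 Ic))/(_ a).
by rewrite msuppX mem_head /= leNgt aw => /(_ isT).
Qed.
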